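(* Let $\lambda<1$. Under any stationary job assignment policy $\Pi$, the steady-state mean response time $\bar T_{N,\Pi}$ of jobs in the system $\mathcal{M}_N$ satisfies $$\liminf_{N\to\infty}\bar T_{N,\Pi}\ \ge\ \frac{z^*}{\lambda},\qquad z^*=\max_{j\in[M]}\Big(\sum_{i=1}^{j-1}\gamma_i+\frac{\lambda-\sum_{i=1}^{j-1}\mu_i\gamma_i}{\mu_j}\Big).$$
   Context: Parameters: $M\in\{1,2,\dots\}$; service rates $\mu_1>\mu_2>\dots>\mu_M>0$; proportions $\gamma_1,\dots,\gamma_M\in(0,1]$ with $\sum_j\gamma_j=1$ and $\sum_j\gamma_j\mu_j=1$; $\lambda>0$; $N$ ranges over the positive integers with $N\gamma_j\in\{1,2,\dots\}$ for all $j\in[M]=\{1,\dots,M\}$ (assumed to exist). System $\mathcal{M}_N$: $N$ servers, $N\gamma_j$ of them of type $j$ with service rate $\mu_j$, each with its own infinite-buffer FCFS queue. Jobs arrive as a Poisson process of rate $N\lambda$, have i.i.d. exponential sizes of mean $1$ (independent of arrivals), and each is assigned on arrival to one server. A stationary policy $\Pi$ assigns each arriving job (possibly at random) depending only on the current state: with $X_{i,j}$ the number of type $j$ servers having at least $i$ jobs (including the one in service), $X_{0,j}=N\gamma_j$, the process $\mathbf{X}^{(N,\Pi)}$ is a continuous-time Markov chain that, from state $\mathbf{X}$, jumps to $\mathbf{X}+\mathbf{e}_{i,j}$ at rate $N\lambda\,a^{\Pi}_{i,j}(\mathbf{X})$ and to $\mathbf{X}-\mathbf{e}_{i,j}$ at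 rate $\mu_j(X_{i,j}-X_{i+1,j})$, where $a^\Pi_{i,j}(\mathbf{X})\ge0$ is the probability that an arriving job is sent to a type $j$ server with exactly $i-1$ jobs, $\sum_{i,j}a^\Pi_{i,j}(\mathbf{X})=1$, and $a^\Pi_{i,j}(\mathbf{X})=0$ if $X_{i-1,j}=X_{i,j}$. The policy is assumed to make the chain ergodic, so that the total number of jobs $R^{(N,\Pi)}(t)=\sum_{i\ge1,j}X^{(N,\Pi)}_{i,j}(t)$ has a steady-state version $R^{(N,\Pi)}(\infty)$. By Little's law the steady-state mean response time (mean total time spent by a job in the system) is $\bar T_{N,\Pi}=\mathbb{E}[R^{(N,\Pi)}(\infty)]/(N\lambda)$. *)

(* Defs.v *)
From HB Require Import structures.
From mathcomp Require Import all_boot all_order all_algebra.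
From mathcomp Require Import all_classical all_reals all_analysis.

Set Implicit Arguments.
Unset Strict Implicit.
Unset Printing Implicit Defensive.

Import Order.TTheory GRing.Theory Num.Theory.
Import numFieldNormedType.Exports.

Local Open Scope classical_set_scope.
Local Open Scope ring_scope.

Section MarkovChain.
Context {R : realType} {T : choiceType}.
Implicit Types (S : set T) (r q : T -> T -> R) (P : R -> T -> T -> R).

(* The conservative Q-matrix on S with jump rates r x y (x != y); the sum has
   finite support, as required by \sum_(_ \in _), when every state of S has
   finitely many possible jumps. *)
Definition qmatrix S r : T -> T -> R :=
  fun x y => if x == y then - \sum_(z \in S `\ x) r x z else r x y.

(* P t x y is the probability to be in y at time t when started from x, for
   the continuous-time Markov chain on S with Q-matrix q; values of P at t < 0
   or outside S are irrelevant. *)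
Record ctmc_transition S q P : Prop := CtmcTransition {
  ctmc_ge0 : forall (t : R) x y, 0 <= t -> S x -> S y -> 0 <= P t x y ;
  ctmc_sum1 : forall (t : R) x, 0 <= t -> S x ->
    (\esum_(y in S) (P t x y)%:E = 1)%E ;
  ctmc_start : forall x y, S x -> S y -> P 0 x y = (x == y)%:R ;
  ctmc_chapman_kolmogorov : forall (s t : R) x y,
    0 <= s -> 0 <= t -> S x -> S y ->
    (P (s + t) x y)%:E = (\esum_(z in S) (P s x z * P t z y)%:E)%E ;
  ctmc_rate : forall x y, S x -> S y ->
    (P h x y - (x == y)%:R) / h @[h --> 0^'+] --> q x y }.

(* Ergodicity of the chain, together with its steady-state distribution p. *)
Record ergodic_with S P (p : T -> R) : Prop := ErgodicWith {
  ergodic_ge0 : forall x, S x -> 0 <= p x ;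
  ergodic_sum1 : (\esum_(x in S) (p x)%:E = 1)%E ;
  ergodic_cvg : forall x y, S x -> S y -> P t x y @[t --> +oo] --> p y }.

End MarkovChain.

(* X i j : number of type j servers with at least i jobs; the types 1, ..., M
   are numbered 0, ..., M - 1 here. *)
Definition conf (M : nat) : Type := nat -> 'I_M -> nat.
HB.instance Definition _ M := Choice.copy (conf M) (nat -> 'I_M -> nat).

(* Pairs (i, j) with i >= 1; the row X 0 j = N * gamma j never changes. *)
Definition positions (M : nat) : set (nat * 'I_M) :=
  [set ij | (1 <= ij.1)%N].

Definition add_job M (X : conf M) (ij : nat * 'I_M) : conf M :=
  fun k l => (X k l + ((k, l) == ij))%N.

Section System.
Context {R : realType} {M : nat}.
Variables (mu gamma : 'I_M -> R) (lambda : R).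

Definition admissible (N : nat) : Prop :=
  (0 < N)%N /\
  forall j, exists2 k : nat, (0 < k)%N & N%:R * gamma j = k%:R.

Definition states (N : nat) : set (conf M) :=
  [set X | [/\ forall j, (X 0%N j)%:R = N%:R * gamma j,
               forall i j, (X i.+1 j <= X i j)%N &
               exists L : nat, forall i j, (L <= i)%N -> X i j = 0%N]].

(* a X i j : probability that a job arriving in state X is sent to a type j
   server with exactly i - 1 jobs. *)
Record stationary_policy (N : nat) (a : conf M -> nat -> 'I_M -> R) : Prop :=
  StationaryPolicy {
  policy_ge0 : forall X i j, states N X -> (1 <= i)%N -> 0 <= a X i j ;
  policy_sum1 : forall X, states N X ->
    (\esum_(ij in @positions M) (a X ij.1 ij.2)%:E = 1)%E ;
  policy_avail : forall X i j, states N X -> (1 <= i)%N ->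
    X i.-1 j = X i j -> a X i j = 0 }.

(* The index sets below contain at most one pair (i, j); the second one says
   Y = X - e_(i, j) without truncated subtraction. *)
Definition jump_rate (N : nat) (a : conf M -> nat -> 'I_M -> R)
    (X Y : conf M) : R :=
  \sum_(ij \in [set ij | positions ij /\ Y = add_job X ij])
     (N%:R * lambda * a X ij.1 ij.2) +
  \sum_(ij \in [set ij | positions ij /\ X = add_job Y ij])
     (mu ij.2 * ((X ij.1 ij.2)%:R - (X ij.1.+1 ij.2)%:R)).

Definition system_transition N a (P : R -> conf M -> conf M -> R) : Prop :=
  ctmc_transition (states N) (qmatrix (states N) (jump_rate N a)) P.

Definition njobs (X : conf M) : \bar R :=
  (\esum_(ij in @positions M) ((X ij.1 ij.2)%:R)%:E)%E.

Definition mean_njobs (N : nat) (p : conf M -> R) : \bar R :=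
  (\esum_(X in states N) ((p X)%:E * njobs X))%E.

(* Little's law *)
Definition mean_response_time (N : nat) (p : conf M -> R) : \bar R :=
  (mean_njobs N p * ((N%:R * lambda)^-1)%:E)%E.

Definition zterm (j : 'I_M) : R :=
  \sum_(i < M | (i < j)%N) gamma i +
  (lambda - \sum_(i < M | (i < j)%N) mu i * gamma i) / mu j.

(* The maximum is started at its first term, so no default value intervenes. *)
Definition zstar (M_gt0 : (0 < M)%N) : R :=
  \big[Num.max/zterm (Ordinal M_gt0)]_(j < M) zterm j.

End System.

(* Main.v *)
(** Stationarity makes the mean drift of any bounded function vanish.  Applied to
    the number of jobs in the first [L] positions of the queues, with [L] large,
    this shows that the mean departure rate [sum_j mu_j E X_(1,j)] is at least
    the arrival rate [N lambda]; no moment of the total number of jobs is needed.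
    Since [X_(1,j) <= N gamma_j] and the total number of jobs is at least
    [sum_j X_(1,j)], linear programming duality bounds its mean below by [N z*],
    for every [N]. *)

Require Import Defs.
From mathcomp Require Import all_boot all_order all_algebra.
From mathcomp Require Import all_classical all_reals all_analysis.
From mathcomp Require Import finmap ring lra.
Import Order.TTheory GRing.Theory Num.Theory.
Import numFieldNormedType.Exports.
Local Open Scope classical_set_scope.
Local Open Scope ring_scope.

(** * Preliminaries: finite subsums of infinite sums, limits of finite sums, Bernoulli's
    inequality *)

Section EsumFset.
Context {R : realType} {T : choiceType}.
Implicit Types (S : set T) (f : T -> R) (G : {fset T}).

Lemma fset_le_esum {S f G} : [set` G] `<=` S ->
  ((\sum_(x <- G) f x)%:E <= \esum_(x in S) (f x)%:E)%E.
Proof.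
move=> GS; apply: esum_ge; exists [set` G]; first by split.
by rewrite -fsbig_seq ?fset_uniq// sumEFin.
Qed.

Lemma esum_fset_lt {S f} (z : R) : (z%:E < \esum_(x in S) (f x)%:E)%E ->
  exists2 G : {fset T}, [set` G] `<=` S & z < \sum_(x <- G) f x.
Proof.
move=> /ereal_sup_gt[_ [A [finA AS] <-]] zA; exists (fset_set A).
  by rewrite fset_setK.
by move: zA; rewrite fsbig_finite//= sumEFin lte_fin.
Qed.

Lemma big_fset_split {V : zmodType} (g : T -> V) {F G : {fset T}} :
  {subset F <= G} ->
  \sum_(x <- G) g x = \sum_(x <- F) g x + \sum_(x <- G | x \notin F) g x.
Proof.
move=> FG; rewrite (bigID (mem F))/=; congr (_ + _).
rewrite -big_filter; apply: perm_big; apply: uniq_perm; rewrite ?filter_uniq//.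
by move=> x; rewrite mem_filter; case: (boolP (x \in F)) => //= /FG ->.
Qed.

End EsumFset.

Lemma cvg_sum_seq {R : realType} {I : eqType} {T : Type} {F : set_system T}
    {FF : Filter F} {r : seq I} {u : I -> T -> R} {l : I -> R} :
  (forall i, i \in r -> u i t @[t --> F] --> l i) ->
  \sum_(i <- r) u i t @[t --> F] --> \sum_(i <- r) l i.
Proof.
move=> ul; under eq_fun do rewrite big_seq; rewrite [\sum_(i <- r) l i]big_seq.
by apply: cvg_big => //; exact: add_continuous.
Qed.

Lemma bernoulli_ineq {R : realType} (a : R) n : 0 <= a <= 1 -> 1 - n%:R * (1 - a) <= a ^+ n.
Proof.
case/andP=> a0 a1; elim: n => [|n IH]; first by rewrite expr0; lra.
have n0 : 0 <= n%:R :> R by [].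
rewrite exprS -natr1; apply: (@le_trans _ _ (a * (1 - n%:R * (1 - a)))).
  have := mulr_ge0 n0 (sqr_ge0 (1 - a)); rewrite expr2; lra.
exact: ler_wpM2l.
Qed.

(** * Ergodic chains: subinvariance and a finite-set form of the vanishing mean drift *)

Section StationaryMarkovChain.
Context {R : realType} {T : choiceType}.
Context {S : set T} {q : T -> T -> R} {P : R -> T -> T -> R} {p : T -> R}.
Hypotheses (Ptr : ctmc_transition S q P) (Pp : ergodic_with S P p).
Implicit Types (F G : {fset T}) (t h : R).

Lemma transition_fsum_le1 {t x G} : 0 <= t -> S x -> [set` G] `<=` S ->
  \sum_(y <- G) P t x y <= 1.
Proof.
move=> t0 Sx GS; rewrite -lee_fin -(ctmc_sum1 Ptr t0 Sx).
exact: fset_le_esum.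
Qed.

Lemma transition_fsum_mul_le {s t x y G} : 0 <= s -> 0 <= t -> S x -> S y ->
  [set` G] `<=` S -> \sum_(z <- G) P s x z * P t z y <= P (s + t) x y.
Proof.
move=> s0 t0 Sx Sy GS.
by rewrite -lee_fin (ctmc_chapman_kolmogorov Ptr)//; exact: fset_le_esum.
Qed.

Lemma transition_mul_le {s t x y z} : 0 <= s -> 0 <= t -> S x -> S y -> S z ->
  P s x z * P t z y <= P (s + t) x y.
Proof.
move=> s0 t0 Sx Sy Sz; have := @transition_fsum_mul_le _ _ _ _ [fset z]%fset s0 t0 Sx Sy.
by rewrite big_seq_fset1; apply => w /=; rewrite inE => /eqP ->.
Qed.

Lemma transition_le1 {t x y} : 0 <= t -> S x -> S y -> P t x y <= 1.
Proof.
move=> t0 Sx Sy; have := @transition_fsum_le1 _ _ [fset y]%fset t0 Sx.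
by rewrite big_seq_fset1; apply => w /=; rewrite inE => /eqP ->.
Qed.

(** Chapman-Kolmogorov from [y] to [y], keeping only the intermediate states in [G], becomes the
    claim as [t] tends to infinity, since the law at time [t] forgets the start. Finiteness of [G]
    lets the limit be taken termwise, at the price of an inequality. *)
Lemma subinvariant {h y G} : 0 <= h -> S y -> [set` G] `<=` S ->
  \sum_(x <- G) p x * P h x y <= p y.
Proof.
move=> h0 Sy GS.
have cvgl : \sum_(x <- G) P t y x * P h x y @[t --> +oo] -->
    \sum_(x <- G) p x * P h x y.
  apply: cvg_sum_seq => x xG; apply: cvgMr_tmp; apply: (ergodic_cvg Pp) => //.
  exact: GS.
have cvgr : P (t + h) y y @[t --> +oo] --> p y.
  exact: (cvg_comp (fun t => t + h) (fun t => P t y y) (cvg_addrr h) (ergodic_cvg Pp Sy Sy)).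
apply: (ler_cvg_to cvgl cvgr); near=> t.
apply: transition_fsum_mul_le => //; near: t; exact: nbhs_pinfty_ge.
Unshelve. all: by end_near.
Qed.

Lemma ergodic_fsum_le1 {F} : [set` F] `<=` S -> \sum_(x <- F) p x <= 1.
Proof.
by move=> FS; rewrite -lee_fin -(ergodic_sum1 Pp); exact: fset_le_esum.
Qed.

Lemma transition_stay_pow {t x} n : 0 <= t -> S x ->
  P t x x ^+ n <= P (n%:R * t) x x.
Proof.
move=> t0 Sx; elim: n => [|n IH].
  by rewrite expr0 mul0r (ctmc_start Ptr)// eqxx.
rewrite exprSr -natr1 mulrDl mul1r; apply: le_trans (transition_mul_le _ _ _ _ Sx) => //.
- by apply: ler_wpM2r => //; exact: (ctmc_ge0 Ptr).
- by rewrite mulr_ge0.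
Qed.

(* Bernoulli's inequality for [P (h / n) x x ^+ n <= P h x x], with [n] to
   infinity, turns the rate at [0] into a bound for all times. *)
Lemma transition_leave_le {C h : R} {x} : S x -> - q x x <= C -> 0 < h ->
  1 - P h x x <= C * h.
Proof.
move=> Sx qC h0; apply: (@le_trans _ _ (- q x x * h)); last by rewrite ler_pM2r.
have cvgn : (h / n.+1%:R : R) @[n --> \oo] --> (0 : R).
  rewrite -[X in _ --> X](mulr0 h); apply: cvgMl_tmp; exact: cvg_harmonic.
have /cvg_at_rightP/(_ (fun n => h / n.+1%:R)) := ctmc_rate Ptr Sx Sx.
move=> /(_ (conj (fun n => divr_gt0 h0 (ltr0Sn _ n)) cvgn)).
rewrite eqxx => cv0;
rewrite mulNr -mulrN.
apply: (cvgr_to_ge (cvgMr_tmp cv0)); near=> n.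
have nz : n.+1%:R != 0 :> R by rewrite pnatr_eq0.
have hn0 : 0 <= h / n.+1%:R by rewrite divr_ge0// ltW.
have := transition_stay_pow n.+1 hn0 Sx.
have -> : n.+1%:R * (h / n.+1%:R) = h by field.
have b : 0 <= P (h / n.+1%:R) x x <= 1.
  by rewrite (ctmc_ge0 Ptr)// transition_le1.
have := bernoulli_ineq _ n.+1 b.
rewrite /=.
have -> : (P (h / n.+1%:R) x x - 1%:R) / (h / n.+1%:R) * - h =
  n.+1%:R * (1 - P (h / n.+1%:R) x x).
  by field; rewrite nat1r nz gt_eqF.
lra.
Unshelve. all: by end_near.
Qed.

(* Subinvariance of [p] is summed over the finite set [G] itself, so that the
   masses of [G `\` F] cancel up to [O(h)]; no infinite sum is exchanged. *)
Lemma generator_fsum_le {C H : R} {f : T -> R} {F G} :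
  0 <= C -> 0 <= H ->
  (forall x, S x -> - q x x <= C) -> (forall x, S x -> 0 <= f x <= H) ->
  [set` F] `<=` [set` G] -> [set` G] `<=` S ->
  \sum_(x <- F) p x * \sum_(y <- G) q x y * f y <=
    C * H * (1 - \sum_(x <- F) p x).
Proof.
move=> C0 H0 qC fH FG GS.
have FS : [set` F] `<=` S := subset_trans FG GS.
(* Mean of [f] at time [h] from [x], counting only the states of [G]; for [x] in [F] its derivative
   at [0] is the inner sum of the claim. *)
pose A h x := \sum_(y <- G) P h x y * f y.
have cvgA x : x \in F -> (A h x - f x) / h @[h --> 0^'+] -->
    \sum_(y <- G) q x y * f y.
  move=> xF; have -> : (fun h => (A h x - f x) / h) =
      (fun h => \sum_(y <- G) (P h x y - (x == y)%:R) / h * f y).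
    apply/funext => h; rewrite /A.
    have -> : f x = \sum_(y <- G) (x == y)%:R * f y.
      rewrite (big_fsetD1 x)/=; last exact: FG.
      rewrite eqxx mul1r big_seq big1 ?addr0// => y.
      by rewrite !inE eq_sym => /andP[/negbTE -> _]; rewrite mul0r.
    rewrite -sumrB mulr_suml; apply: eq_bigr => y _; ring.
  apply: cvg_sum_seq => y yG; apply: cvgMr_tmp.
  by apply: (ctmc_rate Ptr); [exact: FS|exact: GS].
have cvgF : \sum_(x <- F) p x * ((A h x - f x) / h) @[h --> 0^'+] -->
    \sum_(x <- F) p x * \sum_(y <- G) q x y * f y.
  by apply: cvg_sum_seq => x xF; apply: cvgMl_tmp; exact: cvgA.
apply: (cvgr_to_le cvgF); near=> h.
have h0 : 0 < h by [].
have h0' := ltW h0.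
(* Subinvariance weighted by [f >= 0]: the mean of [f] restricted to [G] does not increase. *)
have subinv : \sum_(x <- G) p x * (A h x - f x) <= 0.
  under eq_bigr do rewrite mulrBr mulr_sumr.
  rewrite sumrB subr_le0 exchange_big/= big_seq [leRHS]big_seq.
  apply: ler_sum => y yG; under eq_bigr do rewrite mulrA.
  have Sy := GS _ yG; have /andP[f0 _] := fH y Sy.
  by rewrite -mulr_suml ler_wpM2r// subinvariant.
rewrite (big_fset_split _ FG) in subinv.
(* A state outside [F] loses at most [f x] times its leaving probability, hence at most
   [C * H * h]. *)
have rest : - (C * H * h * \sum_(x <- G | x \notin F) p x) <=
    \sum_(x <- G | x \notin F) p x * (A h x - f x).
  rewrite mulr_sumr -sumrN big_seq_cond [leRHS]big_seq_cond.
  apply: ler_sum => x /andP[xG _].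
  have Sx : S x := GS _ xG.
  have /andP[f0 fH'] := fH x Sx.
  have leave := transition_leave_le Sx (qC x Sx) h0.
  have stay1 : P h x x <= 1 by exact: transition_le1.
  have stayA : P h x x * f x <= A h x.
    rewrite /A (big_fsetD1 x xG)/= lerDl big_seq sumr_ge0// => y.
    rewrite !inE => /andP[_ yG]; have Sy := GS _ yG.
    by have /andP[fy0 _] := fH y Sy; rewrite mulr_ge0// (ctmc_ge0 Ptr).
  rewrite -mulNr mulrC ler_wpM2l ?(ergodic_ge0 Pp)//.
  have stay0 : 0 <= 1 - P h x x by rewrite subr_ge0.
  have := ler_pM stay0 f0 leave fH'; lra.
have mass : \sum_(x <- G | x \notin F) p x <= 1 - \sum_(x <- F) p x.
  by rewrite lerBrDl -big_fset_split// ergodic_fsum_le1.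
have CHh0 : 0 <= C * H * h by rewrite !mulr_ge0.
under eq_bigr do rewrite mulrA.
rewrite -mulr_suml ler_pdivrMr//.
have := ler_wpM2l CHh0 mass; lra.
Unshelve. all: by end_near.
Qed.

End StationaryMarkovChain.

(** * Finite windows of positions and regrouping of jumps *)

Lemma fsbig_seq_cond {V : zmodType} {I : choiceType} (r : seq I) {A : set I}
    {f : I -> V} : uniq r -> (forall i, A i -> i \notin r -> f i = 0) ->
  \sum_(i \in A) f i = \sum_(i <- r | `[<A i>]) f i.
Proof.
move=> ur f0; rewrite (@fsbigE _ _ _ _ _ [seq i <- r | `[<A i>]]).
- rewrite big_filter_cond; apply: eq_bigl => i.
  have -> : (i \in A) = `[<A i>] by apply/idP/asboolP => [/set_mem|/mem_set].
  by rewrite andbb.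
- by rewrite filter_uniq.
- by move=> i /=; rewrite mem_filter => /andP[/asboolP].
- move=> i Ai; rewrite mem_filter asboolT//=; exact: f0.
Qed.

(** Subtraction is truncated: this undoes an arrival only where [X ij.1 ij.2] is positive. At the
    other positions of a state the departure rate is zero. *)
Definition remove_job {M} (X : conf M) (ij : nat * 'I_M) : conf M :=
  fun k l => (X k l - ((k, l) == ij))%N.

Definition box M L : seq (nat * 'I_M) :=
  [seq (i, j) | i <- index_iota 1 L.+1, j <- index_enum 'I_M].

Lemma box_uniq M L : uniq (box M L).
Proof. by rewrite allpairs_uniq ?iota_uniq ?index_enum_uniq// => -[] ? ? []. Qed.

Lemma mem_box {M L} (ij : nat * 'I_M) : (ij \in box M L) = (1 <= ij.1 <= L)%N.
Proof.
case: ij => i j; apply/allpairsP/idP => /= [[[k l] [/=]]|].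
  by rewrite mem_index_iota => kL _ [-> _].
by exists (i, j); rewrite mem_index_iota mem_index_enum.
Qed.

Lemma box_positions {M L} : [set` box M L] `<=` @positions M.
Proof. by move=> ij /=; rewrite mem_box => /andP[]. Qed.

Lemma big_box {V : zmodType} {M L} (g : nat * 'I_M -> V) :
  \sum_(ij <- box M L) g ij = \sum_j \sum_(1 <= i < L.+1) g (i, j).
Proof. by rewrite big_allpairs exchange_big. Qed.

Lemma add_job_remove {M} {X Y : conf M} {ij} : (0 < X ij.1 ij.2)%N ->
  X = add_job Y ij <-> Y = remove_job X ij.
Proof.
move=> X0; split=> ->; apply/funext => k; apply/funext => l.
  by rewrite /add_job /remove_job addnK.
rewrite /add_job /remove_job subnK//; case: eqP => // kl.
by rewrite -kl in X0.
Qed.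

(** Turns a sum over target states into a sum over jumps. Jumps of weight zero may lead outside
    [G]. *)
Lemma sum_by_target {V : nzRingType} {I : eqType} {T : choiceType} {r : seq I}
    {G : {fset T}} {tgt : I -> T} {w : I -> V} (g : T -> V) :
  (forall i, i \in r -> w i != 0 -> tgt i \in G) ->
  \sum_(Y <- G) (\sum_(i <- r | Y == tgt i) w i) * g Y =
  \sum_(i <- r) w i * g (tgt i).
Proof.
move=> wG; under eq_bigr do rewrite big_mkcond mulr_suml.
rewrite exchange_big/= big_seq [RHS]big_seq; apply: eq_bigr => i ir.
have [w0|w0] := eqVneq (w i) 0.
  by rewrite w0 mul0r big1// => Y _; rewrite if_same mul0r.
rewrite (big_fsetD1 (tgt i))/= ?wG// eqxx big_seq big1 ?addr0// => Y.
by rewrite !inE => /andP[/negbTE ->]; rewrite mul0r.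
Qed.

(** * Rates, generator and drift of the job assignment chain *)

Section JobAssignment.
Context {R : realType} {M : nat} {mu gamma : 'I_M -> R} {lambda : R} {N : nat}.
Context {a : conf M -> nat -> 'I_M -> R}.
Hypotheses (mu_gt0 : forall j, 0 < mu j) (lambda_gt0 : 0 < lambda).
Hypothesis gamma_mu_sum : \sum_(j < M) gamma j * mu j = 1.
Hypothesis a_policy : stationary_policy gamma N a.

Let S := states gamma N.
Let q := qmatrix S (jump_rate mu lambda N a).

Definition vanishes_from (L : nat) (X : conf M) :=
  forall i j, (L <= i)%N -> X i j = 0%N.

Definition arrival_rate (X : conf M) (ij : nat * 'I_M) : R :=
  N%:R * lambda * a X ij.1 ij.2.

Definition departure_rate (X : conf M) (ij : nat * 'I_M) : R :=
  mu ij.2 * ((X ij.1 ij.2)%:R - (X ij.1.+1 ij.2)%:R).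

Definition throughput (X : conf M) : R := \sum_j mu j * (X 1%N j)%:R.

Lemma states_monotone {X i j} : S X -> (X i.+1 j <= X i j)%N.
Proof. by case. Qed.

Lemma states_le0 {X} i j : S X -> (X i j <= X 0%N j)%N.
Proof.
move=> SX; elim: i => // i; apply: leq_trans; exact: states_monotone.
Qed.

Lemma states_vanish {X} : S X -> exists L, vanishes_from L X.
Proof. by case. Qed.

(** Above level [L] both [X i.-1 j] and [X i j] are zero, so no job can be sent there. Level [L]
    itself stays in the window: a queue with [L - 1] jobs can still receive one. *)
Lemma policy_eq0 {X L ij} : S X -> vanishes_from L X -> positions ij ->
  ij \notin box M L -> a X ij.1 ij.2 = 0.
Proof.
move=> SX XL ij1; rewrite mem_box ij1/= -ltnNge => Li.
apply: (policy_avail a_policy) => //.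
by rewrite !XL// ?(ltnW Li)// -ltnS prednK// (leq_trans _ Li).
Qed.

Lemma departure_rate_eq0 {X L ij} : vanishes_from L X -> positions ij ->
  ij \notin box M L -> departure_rate X ij = 0.
Proof.
move=> XL ij1; rewrite mem_box ij1/= -ltnNge => Li.
have Li' := ltnW Li.
by rewrite /departure_rate (XL ij.1)// (XL ij.1.+1) ?subrr ?mulr0// ltnW.
Qed.

Lemma departure_rate_ge0 {X ij} : S X -> 0 <= departure_rate X ij.
Proof.
move=> SX; rewrite mulr_ge0 ?(ltW (mu_gt0 _))//.
by rewrite subr_ge0 ler_nat states_monotone.
Qed.

Lemma arrival_rate_ge0 {X L ij} : S X -> ij \in box M L -> 0 <= arrival_rate X ij.
Proof.
move=> SX ijB; rewrite mulr_ge0 ?mulr_ge0 ?ler0n ?(ltW lambda_gt0)//.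
by apply: (policy_ge0 a_policy) => //; exact: box_positions ijB.
Qed.

Lemma sum_arrival_rate {X L} : S X -> vanishes_from L X ->
  \sum_(ij <- box M L) arrival_rate X ij = N%:R * lambda.
Proof.
move=> SX XL; rewrite -mulr_sumr -[RHS]mulr1; congr (_ * _).
apply: EFin_inj; rewrite -(policy_sum1 a_policy SX).
rewrite (esumID [set` box M L]); last first.
  by move=> ij ij1; rewrite lee_fin (policy_ge0 a_policy).
rewrite setIidr; last exact: box_positions.
rewrite [X in (_ + X)%E]esum1 ?adde0; last first.
  move=> ij [ij1 /= ijB]; rewrite (policy_eq0 SX XL ij1)//; exact/negP.
rewrite esum_fset; last 2 first.
- exact: finite_seq.
- move=> ij /set_mem ijB.
  by rewrite lee_fin (policy_ge0 a_policy)//; exact: box_positions ijB.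
by rewrite -fsbig_seq ?box_uniq// sumEFin.
Qed.

Lemma sum_departure_rate {X L} : vanishes_from L X ->
  \sum_(ij <- box M L) departure_rate X ij = throughput X.
Proof.
move=> XL; rewrite big_box; apply: eq_bigr => j _.
rewrite /departure_rate /= -mulr_sumr; congr (_ * _).
(* The levels telescope to [X 1 j - X L.+1 j], whose last term is zero. *)
under eq_bigr do rewrite -opprB.
by rewrite sumrN telescope_sumr// XL// sub0r opprK.
Qed.

Lemma throughput_le {X} : S X -> throughput X <= N%:R.
Proof.
move=> SX; have -> : N%:R = \sum_j N%:R * (gamma j * mu j) :> R.
  by rewrite -mulr_sumr gamma_mu_sum mulr1.
apply: ler_sum => j _.
rewrite mulrA [leRHS]mulrC ler_wpM2l ?(ltW (mu_gt0 _))//.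
case: (SX) => X0 _ _. rewrite -X0 ler_nat; exact: states_le0.
Qed.

(** One window serves all targets [Y], so that sums over targets and over jumps can be exchanged. *)
Lemma jump_rateE {X L} Y : S X -> vanishes_from L X ->
  jump_rate mu lambda N a X Y =
  \sum_(ij <- box M L | Y == add_job X ij) arrival_rate X ij +
  \sum_(ij <- box M L | Y == remove_job X ij) departure_rate X ij.
Proof.
move=> SX XL; rewrite /jump_rate; congr (_ + _).
  rewrite (fsbig_seq_cond _ (box_uniq M L)); last first.
    by move=> ij [ij1 _] ijB; rewrite (policy_eq0 SX XL ij1)// mulr0.
  rewrite big_seq_cond [RHS]big_seq_cond; apply: eq_bigl => ij.
  apply: andb_id2l => ijB; apply/asboolP/eqP => [[]//|->].
  by split=> //; exact: box_positions ijB.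
rewrite (fsbig_seq_cond _ (box_uniq M L)); last first.
  by move=> ij [ij1 _]; exact: departure_rate_eq0.
rewrite -/(departure_rate X) big_mkcond [RHS]big_mkcond big_seq [RHS]big_seq.
apply: eq_bigr => ij ijB; rewrite -/(departure_rate X ij).
(* At an empty position [remove_job] and [add_job] do not match, but the rate is zero there and both
   conditions are harmless. *)
have [d0|d0] := eqVneq (departure_rate X ij) 0; first by rewrite !d0 !if_same.
have X0 : (0 < X ij.1 ij.2)%N.
  rewrite lt0n; apply: contra d0 => /eqP X0.
  have := states_monotone (i := ij.1) (j := ij.2) SX.
  by rewrite X0 leqn0 => /eqP X1; rewrite /departure_rate X0 X1 subrr mulr0.
congr (if _ then _ else _); apply/asboolP/eqP => [[_ ]|]/(add_job_remove X0)//.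
by split=> //; exact: box_positions ijB.
Qed.

Lemma states_add_job {X ij} : S X -> positions ij -> arrival_rate X ij != 0 ->
  S (add_job X ij).
Proof.
move=> SX ij1 u0; case: (SX) => X0 _ [L XL].
(* A nonzero rate excludes equality, and the strict inequality leaves room for the new job, so
   monotonicity in the level survives. *)
have lt_ij : (X ij.1 ij.2 < X ij.1.-1 ij.2)%N.
  rewrite ltn_neqAle -{3}(prednK ij1) states_monotone// andbT.
  apply: contra u0 => /eqP e.
  by rewrite /arrival_rate (policy_avail a_policy)// mulr0.
split=> [j|i j|].
- rewrite /add_job -X0; case: eqP => [e|]; last by rewrite addn0.
  by move: ij1; rewrite /positions/= -e.
- rewrite /add_job; case: eqP => [e|_]; last first.
    by rewrite addn0 (leq_trans (states_monotone SX))// leq_addr.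
  by move: lt_ij; rewrite -e/= addn1 => /leq_trans; apply; exact: leq_addr.
- exists (maxn L ij.1.+1) => i j; rewrite geq_max => /andP[Li ji].
  rewrite /add_job XL//; case: eqP => // e.
  by rewrite -e ltnn in ji.
Qed.

Lemma states_remove_job {X ij} : S X -> positions ij ->
  departure_rate X ij != 0 -> S (remove_job X ij).
Proof.
move=> SX ij1 d0; case: (SX) => X0 _ [L XL].
have lt_ij : (X ij.1.+1 ij.2 < X ij.1 ij.2)%N.
  rewrite ltn_neqAle states_monotone// andbT.
  by apply: contra d0 => /eqP e; rewrite /departure_rate e subrr mulr0.
split=> [j|i j|].
- rewrite /remove_job -X0; case: eqP => [e|]; last by rewrite subn0.
  by move: ij1; rewrite /positions/= -e.
- rewrite /remove_job; apply: leq_trans (leq_subr _ _) _.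
  case: eqP => [e|_]; last by rewrite subn0 states_monotone.
  by move: lt_ij; rewrite -e/=; case: (X i j) => // n; rewrite subn1.
- by exists L => i j Li; rewrite /remove_job XL// sub0n.
Qed.

Lemma sum_jump_rate {X L} {G : {fset conf M}} (g : conf M -> R) :
  S X -> vanishes_from L X ->
  (forall ij, ij \in box M L -> arrival_rate X ij != 0 -> add_job X ij \in G) ->
  (forall ij, ij \in box M L -> departure_rate X ij != 0 ->
     remove_job X ij \in G) ->
  \sum_(Y <- G) jump_rate mu lambda N a X Y * g Y =
  \sum_(ij <- box M L) arrival_rate X ij * g (add_job X ij) +
  \sum_(ij <- box M L) departure_rate X ij * g (remove_job X ij).
Proof.
move=> SX XL addG removeG; rewrite -(sum_by_target _ addG).
rewrite -(sum_by_target _ removeG) -big_split; apply: eq_bigr => Y _.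
by rewrite (jump_rateE _ SX XL) mulrDl.
Qed.

Lemma jump_rate_eq0 {X L Y} {G : {fset conf M}} :
  S X -> vanishes_from L X ->
  (forall ij, ij \in box M L -> arrival_rate X ij != 0 -> add_job X ij \in G) ->
  (forall ij, ij \in box M L -> departure_rate X ij != 0 ->
     remove_job X ij \in G) ->
  Y \notin G -> jump_rate mu lambda N a X Y = 0.
Proof.
move=> SX XL addG removeG YG; rewrite (jump_rateE _ SX XL).
rewrite big_seq_cond [X in _ + X]big_seq_cond.
rewrite !big1 ?addr0// => ij /andP[ijB /eqP e]; apply/eqP.
  by apply: contraNT YG; rewrite e; exact: removeG.
by apply: contraNT YG; rewrite e; exact: addG.
Qed.

(** Once [G] contains [X] and all its neighbours, the row of [q] at [X] is complete and its diagonal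
    entry turns values of [f] into increments. Allowing every larger [G] lets one set serve many
    states at once. *)
Lemma generatorE {X L} : S X -> vanishes_from L X ->
  exists2 G0 : {fset conf M}, [set` G0] `<=` S &
  forall (G : {fset conf M}) (f : conf M -> R),
    [set` G0] `<=` [set` G] -> [set` G] `<=` S ->
    \sum_(Y <- G) q X Y * f Y =
    \sum_(ij <- box M L) arrival_rate X ij * (f (add_job X ij) - f X) +
    \sum_(ij <- box M L) departure_rate X ij * (f (remove_job X ij) - f X).
Proof.
move=> SX XL.
pose rA := [seq add_job X ij | ij <- box M L & arrival_rate X ij != 0].
pose rD := [seq remove_job X ij | ij <- box M L & departure_rate X ij != 0].
exists [fset Y | Y in X :: rA ++ rD]%fset.
  move=> Y /=; rewrite in_fset inE mem_cat => /or3P[/eqP ->//| |].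
    move=> /mapP[ij]; rewrite mem_filter => /andP[u0 ijB] ->.
    by apply: states_add_job => //; exact: box_positions ijB.
  move=> /mapP[ij]; rewrite mem_filter => /andP[u0 ijB] ->.
  by apply: states_remove_job => //; exact: box_positions ijB.
move=> G f G0G GS.
have XG : X \in G by apply: G0G; rewrite /= in_fset inE eqxx.
have addG ij : ij \in box M L -> arrival_rate X ij != 0 -> add_job X ij \in G.
  move=> ijB u0; apply: G0G; rewrite /= in_fset inE mem_cat.
  by apply/or3P/Or32/mapP; exists ij; rewrite // mem_filter u0.
have removeG ij : ij \in box M L -> departure_rate X ij != 0 ->
    remove_job X ij \in G.
  move=> ijB u0; apply: G0G; rewrite /= in_fset inE mem_cat.
  by apply/or3P/Or33/mapP; exists ij; rewrite // mem_filter u0.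
rewrite -(sum_jump_rate (fun Y => f Y - f X) SX XL addG removeG).
rewrite (big_fsetD1 X XG) [RHS](big_fsetD1 X XG)/= subrr mulr0 add0r.
under [RHS]eq_bigr do rewrite mulrBr.
rewrite sumrB addrC -mulr_suml; congr (_ + _).
  rewrite big_seq [RHS]big_seq; apply: eq_bigr => Y.
  by rewrite !inE /q /qmatrix eq_sym => /andP[/negbTE ->].
rewrite /q /qmatrix eqxx mulNr; congr (- (_ * _)).
(* The diagonal entry sums over all states other than [X]; the rates vanish outside [G], so this is
   a sum over [G] without [X]. *)
rewrite (fsbig_seq_cond (G `\ X)%fset) ?fset_uniq//.
  rewrite big_seq_cond [RHS]big_seq; apply: eq_bigl => Y.
  apply: andb_idr => YGX; apply/asboolP; move: YGX.
  rewrite !inE => /andP[YX YG]; split; first exact: GS.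
  exact/eqP.
move=> Y [SY /= YX] YGX; apply: (jump_rate_eq0 SX XL addG removeG).
by move: YGX; rewrite !inE negb_and negbK => /orP[/eqP|].
Qed.

(* Truncation keeps the test function bounded on the states. *)
Definition truncated_njobs (L : nat) (X : conf M) : R :=
  \sum_(ij <- box M L) (X ij.1 ij.2)%:R.

Lemma sum_box_delta {L} (ij : nat * 'I_M) :
  \sum_(kl <- box M L) ((kl.1, kl.2) == ij)%:R = (ij \in box M L)%:R :> R.
Proof.
under eq_bigr do rewrite -surjective_pairing.
case: (boolP (ij \in _)) => [ijB|ijB].
  rewrite (bigD1_seq ij) ?box_uniq//= eqxx big1 ?addr0// => kl.
  by move=> /negbTE ->.
rewrite big_seq big1// => kl klB; case: eqP => // e.
by rewrite -e klB in ijB.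
Qed.

Lemma truncated_njobs_add {L X} ij :
  truncated_njobs L (add_job X ij) = truncated_njobs L X + (ij \in box M L)%:R.
Proof.
rewrite -sum_box_delta -big_split; apply: eq_bigr => kl _.
by rewrite /add_job natrD.
Qed.

Lemma truncated_njobs_remove {L X} ij :
  truncated_njobs L X - 1 <= truncated_njobs L (remove_job X ij).
Proof.
apply: (@le_trans _ _ (truncated_njobs L X - (ij \in box M L)%:R)).
  by rewrite lerD2l lerN2 lern1 leq_b1.
rewrite -sum_box_delta -sumrB; apply: ler_sum => kl _.
by rewrite lerBlDr /remove_job -natrD ler_nat addnC -leq_subLR.
Qed.

Lemma truncated_njobs_bounds {L X} : S X -> 0 <= truncated_njobs L X <=
  \sum_(ij <- box M L) N%:R * gamma ij.2.
Proof.
move=> SX; rewrite sumr_ge0//= ; apply: ler_sum => ij _.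
case: (SX) => X0 _ _; rewrite -X0 ler_nat; exact: states_le0.
Qed.

(** If [X] is empty from level [L] on, every arrival lands in the window and counts fully; otherwise
    arrivals contribute at least zero. Each departure removes at most one counted job. *)
Lemma drift {X} L : S X ->
  exists2 G0 : {fset conf M}, [set` G0] `<=` S &
  forall G : {fset conf M}, [set` G0] `<=` [set` G] -> [set` G] `<=` S ->
    `[<vanishes_from L X>]%:R * (N%:R * lambda) - throughput X <=
    \sum_(Y <- G) q X Y * truncated_njobs L Y.
Proof.
(* [K] bounds the levels of [X], and is [L] itself whenever possible, so that the arrivals of [X]
   are then exactly those counted. *)
move=> SX; have [K [XK KL]] : exists K, vanishes_from K X /\
    (vanishes_from L X -> K = L).
  have [XL|XL] := pselect (vanishes_from L X); first by exists L.
  by have [K XK] := states_vanish SX; exists K.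
have [G0 G0S genE] := generatorE SX XK; exists G0 => // G G0G GS.
rewrite genE// lerD//; last first.
  rewrite -(sum_departure_rate XK) -sumrN; apply: ler_sum => ij _.
  have := departure_rate_ge0 (ij := ij) SX.
  by have := @truncated_njobs_remove L X ij; nra.
under eq_bigr do rewrite truncated_njobs_add addrAC subrr add0r.
case: asboolP => [XL|_]; last first.
  rewrite mul0r big_seq sumr_ge0// => ij ijB.
  by rewrite mulr_ge0// (arrival_rate_ge0 SX ijB).
rewrite mul1r -(sum_arrival_rate SX XL) (KL XL) big_seq [leRHS]big_seq.
by apply: ler_sum => ij ->; rewrite mulr1.
Qed.

(** Uniform bound required by [generator_fsum_le]. The generator applied to the indicator of [X]
    yields [q X X], at most the total arrival and departure rates in absolute value. *)
Lemma exit_rate_le {X} : S X -> - q X X <= N%:R * lambda + N%:R.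
Proof.
move=> SX; have [L XL] := states_vanish SX.
have [G0 G0S genE] := generatorE SX XL.
pose G := (X |` G0)%fset.
have GS : [set` G] `<=` S.
  by move=> Y /=; rewrite !inE => /orP[/eqP ->//|]; exact: G0S.
have := genE G (fun Y => (Y == X)%:R) (fun Y => @fset1Ur _ Y X G0) GS.
rewrite (big_fsetD1 X) ?fset1U1//= eqxx mulr1 big_seq big1 ?addr0; last first.
  by move=> Y; rewrite !inE => /andP[/negbTE -> _]; rewrite mulr0.
move=> ->; rewrite -(sum_arrival_rate SX XL).
apply: (@le_trans _ _ (\sum_(ij <- box M L) arrival_rate X ij + throughput X)).
  rewrite -(sum_departure_rate XL) opprD -!sumrN lerD//.
    rewrite big_seq [leRHS]big_seq; apply: ler_sum => ij ijB.
    rewrite -mulrN ler_piMr ?(arrival_rate_ge0 SX ijB)//.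
    by rewrite opprB lerBlDr lerDl.
  apply: ler_sum => ij _; rewrite -mulrN ler_piMr ?departure_rate_ge0//.
  by rewrite opprB lerBlDr lerDl.
by rewrite lerD2l throughput_le.
Qed.

End JobAssignment.

(** * Steady-state throughput and the bound on the mean number of jobs *)

Section SteadyState.
Context {R : realType} {M : nat} {mu gamma : 'I_M -> R} {lambda : R} {N : nat}.
Context {a : conf M -> nat -> 'I_M -> R} {P : R -> conf M -> conf M -> R}.
Context {p : conf M -> R}.
Hypotheses (mu_gt0 : forall j, 0 < mu j) (lambda_gt0 : 0 < lambda).
Hypothesis mu_decr : forall i j : 'I_M, (i < j)%N -> mu j < mu i.
Hypothesis gamma_gt0 : forall j, 0 < gamma j.
Hypothesis gamma_mu_sum : \sum_(j < M) gamma j * mu j = 1.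
Hypothesis a_policy : stationary_policy gamma N a.
Hypothesis P_chain : system_transition mu gamma lambda N a P.
Hypothesis p_steady : ergodic_with (states gamma N) P p.

Let S := states gamma N.

Lemma ergodic_fsum_gt {e : R} : 0 < e ->
  exists2 F : {fset conf M}, [set` F] `<=` S & 1 - e < \sum_(X <- F) p X.
Proof.
move=> e0; apply: esum_fset_lt; rewrite (ergodic_sum1 p_steady).
by rewrite lte_fin ltrBlDr ltrDl.
Qed.

Lemma vanishing_bound {F : {fset conf M}} : [set` F] `<=` S ->
  exists L, forall X, X \in F -> vanishes_from L X.
Proof.
move=> FS.
have /choice[len lenE] : forall X, exists L, S X -> vanishes_from L X.
  move=> X; have [SX|nSX] := pselect (S X); last by exists 0%N.
  by have [L XL] := states_vanish SX; exists L.
exists (\max_(X <- F) len X) => X XF i j Li; apply: (lenE X (FS _ XF)).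
by apply: leq_trans Li; rewrite leq_bigmax_seq.
Qed.

(** The order of choices matters: [F1] carries almost all mass and fixes the level [L], which fixes
    the bound [H]; only then is [F2] chosen, with missing mass small compared with [C * H]. *)
Lemma throughput_fsum_ge {e : R} : 0 < e ->
  exists2 F : {fset conf M}, [set` F] `<=` S &
    N%:R * lambda - e <= \sum_(X <- F) p X * throughput (mu := mu) X.
Proof.
move=> e0.
have Nl0 : 0 <= N%:R * lambda by rewrite mulr_ge0 ?ler0n ?ltW.
(* Half of [e] pays for the arrivals lost outside [F1]; the [+ 1] keeps the denominator positive. *)
have d0 : 0 < e / 2 / (N%:R * lambda + 1) by rewrite !divr_gt0// ltr_wpDl.
have [F1 F1S pF1] := ergodic_fsum_gt d0.
have [L F1L] := vanishing_bound F1S.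
pose C : R := N%:R * lambda + N%:R.
pose H : R := \sum_(ij <- box M L) N%:R * gamma ij.2.
have C0 : 0 <= C by rewrite addr_ge0.
have H0 : 0 <= H.
  by apply: sumr_ge0 => ij _; rewrite mulr_ge0 ?ler0n ?ltW.
(* The other half of [e] pays for the error term of [generator_fsum_le]. *)
have c0 : 0 < e / 2 / (C * H + 1) by rewrite !divr_gt0// ltr_wpDl// mulr_ge0.
have [F2 F2S pF2] := ergodic_fsum_gt c0.
pose F := (F1 `|` F2)%fset.
have FS : [set` F] `<=` S.
  by move=> X /=; rewrite !inE => /orP[]; [exact: F1S|exact: F2S].
have p_sub (F' : {fset conf M}) : {subset F' <= F} ->
    \sum_(X <- F') p X <= \sum_(X <- F) p X.
  move=> F'F; rewrite (big_fset_split _ F'F) lerDl big_seq_cond sumr_ge0// => X.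
  by move=> /andP[/FS SX _]; exact: (ergodic_ge0 p_steady).
have /choice[G0 G0P] : forall X, exists G0 : {fset conf M}, S X ->
    [set` G0] `<=` S /\ (forall G : {fset conf M},
    [set` G0] `<=` [set` G] -> [set` G] `<=` S ->
    `[<vanishes_from L X>]%:R * (N%:R * lambda) - throughput (mu := mu) X <=
    \sum_(Y <- G) qmatrix S (jump_rate mu lambda N a) X Y *
                  truncated_njobs L Y).
  move=> X; have [SX|nSX] := pselect (S X); last by exists fset0.
  have [G0 G0S G0P] := drift mu_gt0 lambda_gt0 a_policy L SX.
  by exists G0.
(* All neighbours of states of [F] are added, so that [drift] applies at each of them with the same
   [G]. *)
pose G := (F `|` \bigcup_(X <- F) G0 X)%fset.
have GS : [set` G] `<=` S.
  move=> Y /=; rewrite in_fsetU => /orP[/FS//|/bigfcupP[X /andP[XF _]]].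
  exact: (G0P X (FS _ XF)).1.
have FG : [set` F] `<=` [set` G] by move=> X /= XF; rewrite in_fsetU XF.
have G0G X : X \in F -> [set` G0 X] `<=` [set` G].
  move=> XF Y /= YG; rewrite in_fsetU; apply/orP; right.
  by apply/bigfcupP; exists X => //; rewrite XF.
have key := generator_fsum_le P_chain p_steady C0 H0
  (fun X => exit_rate_le mu_gt0 lambda_gt0 gamma_mu_sum a_policy)
  (fun X => truncated_njobs_bounds (L := L)) FG GS.
exists F => //.
(* The states of [F1] vanish from [L] and supply the arrival rate; for the rest of [F] the arrival
   part is only known to be nonnegative. *)
have low : N%:R * lambda * \sum_(X <- F1) p X -
    \sum_(X <- F) p X * throughput (mu := mu) X <= C * H * (1 - \sum_(X <- F) p X).
  apply: le_trans key.
  apply: (@le_trans _ _ (\sum_(X <- F) p X *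
      (`[<vanishes_from L X>]%:R * (N%:R * lambda) - throughput (mu := mu) X))).
    under [leRHS]eq_bigr do rewrite mulrBr.
    rewrite sumrB lerD2r.
    have F1F : {subset F1 <= F} by move=> X XF1; rewrite in_fsetU XF1.
    rewrite (big_fset_split _ F1F) -[leLHS]addr0 lerD//.
      rewrite mulr_sumr big_seq [leRHS]big_seq; apply: ler_sum => X XF1.
      by rewrite asboolT ?mul1r 1?mulrC//; exact: F1L.
    rewrite big_seq_cond sumr_ge0// => X /andP[/FS SX _].
    by apply: mulr_ge0; [exact: (ergodic_ge0 p_steady)|exact: mulr_ge0].
  rewrite big_seq [leRHS]big_seq; apply: ler_sum => X XF.
  rewrite ler_wpM2l ?(ergodic_ge0 p_steady)//; first exact: FS.
  by apply: (G0P X (FS _ XF)).2 => //; exact: G0G.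
have pF : 1 - e / 2 / (C * H + 1) <= \sum_(X <- F) p X.
  apply: le_trans (ltW pF2) _; apply: p_sub => X XF2.
  by rewrite in_fsetU XF2 orbT.
have CH0 : 0 <= C * H by rewrite mulr_ge0.
have b1 : C * H * (1 - \sum_(X <- F) p X) <= e / 2.
  apply: (@le_trans _ _ ((C * H + 1) * (e / 2 / (C * H + 1)))).
    apply: ler_pM; [by []|by rewrite subr_ge0 (ergodic_fsum_le1 p_steady)|lra|lra].
  by rewrite [leLHS]mulrC divfK// gt_eqF// ltr_wpDl.
have b2 : N%:R * lambda * (1 - \sum_(X <- F1) p X) <= e / 2.
  apply: (@le_trans _ _ ((N%:R * lambda + 1) * (e / 2 / (N%:R * lambda + 1)))).
    apply: ler_pM; [by []|by rewrite subr_ge0 (ergodic_fsum_le1 p_steady)|lra|lra].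
  by rewrite [leLHS]mulrC divfK// gt_eqF// ltr_wpDl.
lra.
Qed.

(* Weak duality for the linear program minimising the number of busy servers
   subject to the throughput: the multiplier of type [j] is [1 / mu j]. *)
Lemma busy_servers_ge {X} (j : 'I_M) : S X ->
  throughput (mu := mu) X / mu j +
  N%:R * \sum_(i < M | (i < j)%N) gamma i * (1 - mu i / mu j) <=
  \sum_i (X 1%N i)%:R.
Proof.
move=> SX; rewrite /throughput mulr_suml mulr_sumr [X in _ + X]big_mkcond.
rewrite -big_split; apply: ler_sum => i _ /=.
have X1 : (X 1%N i)%:R <= N%:R * gamma i.
  by case: (SX) => X0 _ _; rewrite -X0 ler_nat (states_le0 1 i SX).
have X0 : 0 <= (X 1%N i)%:R :> R by [].
have ji : mu i / mu j * (X 1%N i)%:R = mu i * (X 1%N i)%:R / mu j.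
  by rewrite mulrAC.
(* For [i < j] the gap is [(mu i / mu j - 1) * (N * gamma i - X 1 i)], a product of nonnegative
   factors; for [i >= j] the ratio is at most [1]. *)
rewrite -ji; case: ltnP => [ij|ji'].
  have : 1 < mu i / mu j by rewrite ltr_pdivlMr// mul1r mu_decr.
  nra.
rewrite addr0 ler_piMl// ler_pdivrMr// mul1r.
move: ji'; rewrite leq_eqVlt => /predU1P[/val_inj ->//|/mu_decr/ltW//].
Qed.

Lemma zterm_le_mean_njobs (j : 'I_M) :
  ((N%:R * zterm mu gamma lambda j)%:E <= mean_njobs gamma N p)%E.
Proof.
pose c : R := \sum_(i < M | (i < j)%N) gamma i * (1 - mu i / mu j).
have c0 : c <= 0.
  apply: sumr_le0 => i ij; rewrite mulr_ge0_le0 ?ltW//.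
  by rewrite subr_lt0 ltr_pdivlMr// mul1r mu_decr.
have ztermE : N%:R * zterm mu gamma lambda j = N%:R * lambda / mu j + N%:R * c.
  rewrite /zterm -mulrA -mulrDr; congr (_ * _).
  rewrite mulrBl addrCA; congr (_ + _); rewrite mulr_suml -sumrB.
  by apply: eq_bigr => i _; rewrite mulrBr mulr1 mulrA [mu i * _]mulrC.
apply/lee_addgt0Pr => e e0.
(* The throughput is divided by [mu j] below, which turns this tolerance into [e]. *)
have e0' : 0 < e * mu j by rewrite mulr_gt0.
have [F FS pF] := throughput_fsum_ge e0'.
apply: (@le_trans _ _ ((\sum_(X <- F) p X * \sum_i (X 1%N i)%:R)%:E + e%:E)%E).
  rewrite -EFinD lee_fin ztermE.
  apply: (@le_trans _ _ (\sum_(X <- F) p X *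
      (throughput (mu := mu) X / mu j + N%:R * c) + e)); last first.
    rewrite lerD2r big_seq [leRHS]big_seq; apply: ler_sum => X XF.
    by rewrite ler_wpM2l ?(ergodic_ge0 p_steady) ?busy_servers_ge//; exact: FS.
  under [X in _ <= X + _]eq_bigr do rewrite mulrDr mulrA.
  rewrite big_split/= -!mulr_suml.
  have s1 := ergodic_fsum_le1 p_steady FS.
  have Nc : N%:R * c <= 0 by rewrite mulr_ge0_le0.
  (* [F] may carry mass below [1]; as [c <= 0], this only increases the constant term. *)
  have sc : N%:R * c <= (\sum_(X <- F) p X) * (N%:R * c).
    by rewrite -[leLHS]mul1r ler_wnM2r.
  have : N%:R * lambda / mu j - e <=
      (\sum_(X <- F) p X * throughput (mu := mu) X) / mu j.
    by rewrite ler_pdivlMr// mulrBl divfK// gt_eqF.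
  lra.
rewrite leeD2r//; apply: esum_ge; exists [set` F]; first by split.
rewrite -fsbig_seq ?fset_uniq// -sumEFin big_seq [leRHS]big_seq.
apply: lee_sum => X XF; have SX := FS _ XF.
rewrite EFinM lee_wpmul2l ?lee_fin ?(ergodic_ge0 p_steady)//.
(* The first row alone, the number of busy servers, bounds the number of jobs below. *)
pose row1 := [seq (1%N, i) | i <- index_enum 'I_M].
apply: esum_ge; exists [set` row1].
  by split=> [|ij /mapP[i _ ->]//]; exact: finite_seq.
rewrite -fsbig_seq; last by rewrite map_inj_uniq ?index_enum_uniq// => ? ? [].
by rewrite sumEFin big_map.
Qed.

End SteadyState.

(** * From the bound for each admissible [N] to the lower limit *)

Theorem corollary6 (R : realType) (M : nat) (M_gt0 : (0 < M)%N)
  (mu gamma : 'I_M -> R) (lambda : R)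
  (mu_gt0 : forall j, 0 < mu j)
  (mu_decr : forall i j : 'I_M, (i < j)%N -> mu j < mu i)
  (gamma_range : forall j, 0 < gamma j <= 1)
  (gamma_sum : \sum_(j < M) gamma j = 1)
  (gamma_mu_sum : \sum_(j < M) gamma j * mu j = 1)
  (admissible_ex : exists N : nat, admissible gamma N)
  (lambda_gt0 : 0 < lambda) (lambda_lt1 : lambda < 1)
  (a : nat -> conf M -> nat -> 'I_M -> R)
  (a_policy : forall N, admissible gamma N -> stationary_policy gamma N (a N))
  (P : nat -> R -> conf M -> conf M -> R)
  (P_chain : forall N, admissible gamma N ->
     system_transition mu gamma lambda N (a N) (P N))
  (p : nat -> conf M -> R)
  (p_steady : forall N, admissible gamma N ->
     ergodic_with (states gamma N) (P N) (p N)) :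
  ((zstar mu gamma lambda M_gt0 / lambda)%:E <=
   limf_einf (fun N => mean_response_time gamma lambda N (p N))
             (within (admissible gamma) \oo))%E.
Proof.
have [jstar zE] : exists j, zstar mu gamma lambda M_gt0 = zterm mu gamma lambda j.
  rewrite /zstar; elim/big_rec: _ => [|j z _ [k ->]]; first by eexists.
  by rewrite /Num.max; case: ifP => _; [exists k|exists j].
rewrite limf_einfE; apply: le_ereal_sup_tmp.
(* The bound holds for every admissible [N], so the whole admissible set can serve as the tail in
   the supremum of infima. *)
exists (ereal_inf [set mean_response_time gamma lambda N (p N) | N in admissible gamma]).
  by exists (admissible gamma) => //; exact: withinT.
apply: le_ereal_inf_tmp => _ [N admN <-].
have N0 : 0 < N%:R * lambda by case: admN => N0 _; rewrite mulr_gt0// ltr0n.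
rewrite /mean_response_time.
have -> : zstar mu gamma lambda M_gt0 / lambda =
    N%:R * zterm mu gamma lambda jstar * (N%:R * lambda)^-1.
  have Nn0 : N%:R != 0 :> R by case: admN => N0' _; rewrite pnatr_eq0 -lt0n.
  by rewrite zE; field; rewrite Nn0 gt_eqF.
rewrite EFinM lee_wpmul2r ?lee_fin ?invr_ge0 ?(ltW N0)//.
have gamma_gt0 j : 0 < gamma j by case/andP: (gamma_range j).
exact: (zterm_le_mean_njobs mu_gt0 lambda_gt0 mu_decr gamma_gt0 gamma_mu_sum
  (a_policy N admN) (P_chain N admN) (p_steady N admN)).
Qed.
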